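(* Let $F:\mathbb{R}^p\to\mathbb{R}^p$ be single-valued and $L$-Lipschitz continuous ($L>0$), let $T:\mathbb{R}^p\rightrightarrows 2^{\mathbb{R}^p}$ be possibly multivalued, and assume that $F+T$ is $\rho$-co-hypomonotone with $\rho\ge0$ and $8\sqrt3L\rho<1$. Assume $\mathrm{zer}(F+T)\neq\emptyset$ and let $x^\star\in\mathrm{zer}(F+T)$ be an arbitrary solution. Then there exists $\gamma>0$ such that $$16L^2\big[3(3\gamma+2\rho)^2+\gamma(2\gamma+\rho)\big]\le1.$$ Moreover, for any such $\gamma$, let $\{(x^k,y^k,z^k)\}$ (together with $\hat w^k$, $\xi^k$) be generated by the scheme (APEG) described in the context, with the parameters $$t_k:=k+2,\quad \eta:=2(3\gamma+2\rho),\quad \hat\eta_k:=\frac{(t_k-1)\eta}{t_k},\quad \theta_k:=\frac{t_k-1}{t_{k+1}},\quad \nu_k:=\frac{t_k}{t_{k+1}}.$$ Then, for all $k\ge0$, $$\|Fx^k+\xi^k\|^2\le\frac{4\|x^0-x^\star\|^2+8\gamma(5\gamma+2\rho)\|Fx^0+\xi^0\|^2}{\gamma^2(k+2)(k+4)},\qquad\text{where }\xi^k\in Tx^k.$$ Consequently, if $J_{\eta T}$ is nonexpansive, then for all $k\ge 0$, $$\|\mathcal{G}_\eta x^k\|^2\le\frac{4\|x^0-x^\star\|^2+8\gamma(5\gamma+2\rho)\|Fx^0+\xi^0\|^2}{\gamma^2(k+2)(k+4)}.$$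
   Context: $\mathbb{R}^p$ carries the standard inner product $\langle\cdot,\cdot\rangle$ and Euclidean norm $\|\cdot\|$. A (possibly multivalued) operator $G$ on $\mathbb{R}^p$ is $\rho$-co-hypomonotone if $\langle u-v,x-y\rangle\ge-\rho\|u-v\|^2$ for all $x,y$ and all $u\in Gx$, $v\in Gy$ (for $\rho=0$ this is monotonicity). $\mathrm{zer}(F+T):=\{x: 0\in Fx+Tx\}$. The resolvent is $J_{\eta T}u:=\{x\in\mathbb{R}^p: u\in x+\eta Tx\}$. ''$J_{\eta T}$ is nonexpansive'' means that $J_{\eta T}$ is a single-valued map $\mathbb{R}^p\to\mathbb{R}^p$ that is $1$-Lipschitz. In that case the residual operator is $\mathcal{G}_\eta x:=\frac1\eta\big(x-J_{\eta T}(x-\eta Fx)\big)$. Scheme (APEG): given $x^0\in\mathbb{R}^p$ with some $\xi^0\in Tx^0$, set $z^0=y^0:=x^0$, $w^0:=Fx^0+\xi^0$ and $\hat w^{-1}:=\frac{\eta}{\hat\eta_0}w^0$. For $k\ge0$, $$\begin{aligned} x^k&:=J_{\eta T}\big(y^k-\eta Fy^k+\hat\eta_k\hat w^{k-1}\big),\\ \hat w^k&:=\tfrac1\eta\big(y^k-x^k+\hat\eta_k\hat w^{k-1}\big),\\ z^{k+1}&:=x^k-\gamma\hat w^k,\\ y^{k+1}&:=z^{k+1}+\theta_k(z^{k+1}-z^k)+\nu_k(y^k-z^{k+1}). \end{aligned}$$ For $k=0$ the first line is satisfied by the given $x^0$, and $\hat w^0=w^0$. The iterates are assumed to exist; if $J_{\eta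 T}$ is multivalued, the first line means that $x^k$ is an element of the right-hand side (for $k=0$, the given $x^0$). The element $\xi^k$ is $\xi^k:=\hat w^k-Fy^k\in Tx^k$. *)

(* Defs.v *)
From mathcomp Require Import all_boot all_order all_algebra.
From mathcomp Require Export classical_sets reals.

Set Implicit Arguments.
Unset Strict Implicit.
Unset Printing Implicit Defensive.

Import Order.TTheory GRing.Theory Num.Theory.
Local Open Scope classical_set_scope.
Local Open Scope ring_scope.

(* The norm `|_| that MathComp-Analysis puts on 'rV[R]_p is the sup norm,
   hence a separate Euclidean structure. *)
Definition dot (R : realType) (p : nat) (u v : 'rV[R]_p) : R :=
  \sum_(i < p) u 0 i * v 0 i.

Definition enorm (R : realType) (p : nat) (u : 'rV[R]_p) : R :=
  Num.sqrt (dot u u).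

Definition elipschitz (R : realType) (p : nat) (L : R)
    (F : 'rV[R]_p -> 'rV[R]_p) : Prop :=
  forall x y, enorm (F x - F y) <= L * enorm (x - y).

(* A multivalued operator on R^p is a map from R^p to sets of R^p; G x u
   reads as u \in G x. *)
Definition sum_op (R : realType) (p : nat) (F : 'rV[R]_p -> 'rV[R]_p)
    (T : 'rV[R]_p -> set 'rV[R]_p) : 'rV[R]_p -> set 'rV[R]_p :=
  fun x => [set F x + xi | xi in T x].

Definition co_hypomonotone (R : realType) (p : nat) (rho : R)
    (G : 'rV[R]_p -> set 'rV[R]_p) : Prop :=
  forall x y u v, G x u -> G y v ->
    - rho * enorm (u - v) ^+ 2 <= dot (u - v) (x - y).

Definition zer (R : realType) (p : nat) (G : 'rV[R]_p -> set 'rV[R]_p) :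
  set 'rV[R]_p := [set x | G x 0].

Definition resolvent (R : realType) (p : nat) (eta : R)
    (T : 'rV[R]_p -> set 'rV[R]_p) : 'rV[R]_p -> set 'rV[R]_p :=
  fun u => [set x | [set x + eta *: xi | xi in T x] u].

Definition single_valued_as (R : realType) (p : nat)
    (G : 'rV[R]_p -> set 'rV[R]_p) (J : 'rV[R]_p -> 'rV[R]_p) : Prop :=
  forall u, G u = [set J u].

Definition nonexpansive (R : realType) (p : nat) (J : 'rV[R]_p -> 'rV[R]_p) :
  Prop := elipschitz 1 J.

(* J stands for the resolvent of eta T when the latter is single-valued. *)
Definition residual (R : realType) (p : nat) (eta : R)
    (F J : 'rV[R]_p -> 'rV[R]_p) (x : 'rV[R]_p) : 'rV[R]_p :=
  eta^-1 *: (x - J (x - eta *: F x)).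

(* The sequence k |-> hat w^{k-1}, where hat w^{-1} = (eta / hat eta_0) w^0. *)
Definition what_pred (R : realType) (p : nat) (eta : R)
    (etah : nat -> R) (w0 : 'rV[R]_p) (wh : nat -> 'rV[R]_p) (k : nat) :
  'rV[R]_p :=
  if k is k'.+1 then wh k' else (eta / etah 0%N) *: w0.

(* The starting point x^0 is x 0. When the resolvent is multivalued, x k is
   only required to be one of its values. *)
Record apeg (R : realType) (p : nat) (F : 'rV[R]_p -> 'rV[R]_p)
    (T : 'rV[R]_p -> set 'rV[R]_p) (gamma eta : R)
    (etah theta nu : nat -> R) (xi0 : 'rV[R]_p)
    (x y z wh : nat -> 'rV[R]_p) : Prop := APEG {
  apeg_xi0 : T (x 0%N) xi0 ;
  apeg_y0 : y 0%N = x 0%N ;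
  apeg_z0 : z 0%N = x 0%N ;
  apeg_x : forall k, resolvent eta T
    (y k - eta *: F (y k)
     + etah k *: what_pred eta etah (F (x 0%N) + xi0) wh k) (x k) ;
  apeg_wh : forall k, wh k = eta^-1 *:
    (y k - x k + etah k *: what_pred eta etah (F (x 0%N) + xi0) wh k) ;
  apeg_z : forall k, z k.+1 = x k - gamma *: wh k ;
  apeg_y : forall k, y k.+1 =
    z k.+1 + theta k *: (z k.+1 - z k) + nu k *: (y k - z k.+1)
}.

Definition apeg_xi (R : realType) (p : nat) (F : 'rV[R]_p -> 'rV[R]_p)
    (y wh : nat -> 'rV[R]_p) (k : nat) :
  'rV[R]_p :=
  wh k - F (y k).

Definition t_ {R : realType} (k : nat) : R := (k + 2)%:R.

Definition gamma_cond (R : realType) (L rho gamma : R) : Prop :=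
  16 * L ^+ 2 * (3 * (3 * gamma + 2 * rho) ^+ 2 + gamma * (2 * gamma + rho))
    <= 1.

Definition eta_ (R : realType) (gamma rho : R) : R := 2 * (3 * gamma + 2 * rho).

Definition etah_ (R : realType) (gamma rho : R) (k : nat) : R :=
  (t_ k - 1) * eta_ gamma rho / t_ k.

Definition theta_ {R : realType} (k : nat) : R := (t_ k - 1) / t_ k.+1.

Definition nu_ {R : realType} (k : nat) : R := t_ k / t_ k.+1.

(* Main.v *)
Require Import Defs.
From mathcomp Require Import all_boot all_order all_algebra.
From mathcomp Require Import classical_sets reals.
From mathcomp Require Import ring lra.

Import Order.TTheory GRing.Theory Num.Theory.
Local Open Scope classical_set_scope.
Local Open Scope ring_scope.

(** Write w_k = F x_k + xi_k for the residual and h_k = wh k = F y_k + xi_k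
for its surrogate.  Two observations drive the proof.

The momentum form hides a Halpern iteration: with the given theta and nu, the
vector z_k + t_k (y_k - z_k) does not depend on k and therefore equals x_0
([halpern]).  Eliminating y and z leaves
[[
  t_{k+1} (x_{k+1} - x_0)
    = t_k (x_k - x_0) + (eta - gamma) t_k h_k - eta t_{k+1} h_{k+1},
]]
which is [anchored_step].  Since t_{k+1} = t_k + 1, the inner product of
w_{k+1} - w_k with x_{k+1} - x_k, weighted by t_k t_{k+1}, then telescopes in
t_k <w_k, x_k - x_0> up to a cross term ([monotone_telescope]).

Consequently the [potential]
[[
  t_k <w_k, x_k - x_0> + (gamma/2 t_k^2 + (rho + gamma/2) t_k) |w_k|^2
    + (3/2) eta t_k^2 |w_k - h_k|^2
]]
is nonincreasing ([potential_decrease]).  The error w_k - h_k equals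
F x_k - F y_k, and x_{k+1} - y_{k+1} is eta / t_{k+1} times the increment of
- t h, so the Lipschitz property and the condition on gamma bound the error by
a small fraction of that increment ([apeg_err]); this is what absorbs the cross
term ([cross_term_bound]).  In this step co-hypomonotonicity is used with the
larger constant rho + gamma/2: the surplus gamma/2 is what turns the factor
(k+2)^2 into (k+2)(k+4) in the final rate.

Finally, co-hypomonotonicity at the pair (x_k, xs) bounds the potential from
below by a quadratic in t_k |w_k| with linear term t_k <w_k, xs - x_0>, and
Young's inequality gives the rate ([apeg_rate]).  The residual operator obeys
the same bound, because x_k is the resolvent of x_k + eta xi_k and the resolvent
is nonexpansive ([residual_le]). *)

(** * Euclidean inner product *)

Section InnerProduct.
Context {R : realType} {p : nat}.
Implicit Types (u v w : 'rV[R]_p) (c : R).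

Lemma dotC u v : dot u v = dot v u.
Proof. by apply: eq_bigr => i _; rewrite mulrC. Qed.

Lemma dotDl u v w : dot (u + v) w = dot u w + dot v w.
Proof. by rewrite -big_split; apply: eq_bigr => i _; rewrite mxE mulrDl. Qed.

Lemma dotZl c u v : dot (c *: u) v = c * dot u v.
Proof. by rewrite /dot mulr_sumr; apply: eq_bigr => i _; rewrite mxE mulrA. Qed.

Lemma dotNl u v : dot (- u) v = - dot u v.
Proof. by rewrite -scaleN1r dotZl mulN1r. Qed.

Lemma dotDr u v w : dot w (u + v) = dot w u + dot w v.
Proof. by rewrite dotC dotDl !(dotC _ w). Qed.

Lemma dotZr c u v : dot u (c *: v) = c * dot u v.
Proof. by rewrite dotC dotZl dotC. Qed.

Lemma dotNr u v : dot u (- v) = - dot u v.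
Proof. by rewrite dotC dotNl dotC. Qed.

Definition dotE := (dotDl, dotDr, dotNl, dotNr, dotZl, dotZr).

Lemma dot_ge0 u : 0 <= dot u u.
Proof. by apply: sumr_ge0 => i _; rewrite -expr2 sqr_ge0. Qed.

Lemma enorm_sqr u : enorm u ^+ 2 = dot u u.
Proof. by rewrite sqr_sqrtr ?dot_ge0. Qed.

Lemma enorm_ge0 u : 0 <= enorm u.
Proof. exact: sqrtr_ge0. Qed.

Lemma elipschitz_sqr {L : R} {F : 'rV[R]_p -> 'rV[R]_p} u v :
  elipschitz L F ->
  dot (F u - F v) (F u - F v) <= L ^+ 2 * dot (u - v) (u - v).
Proof.
move=> lipF; rewrite -!enorm_sqr -exprMn !expr2.
by apply: ler_pM; rewrite ?enorm_ge0.
Qed.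

Lemma dot_young c u v : - (2 * c) * dot u v <= c ^+ 2 * dot u u + dot v v.
Proof. by have := dot_ge0 (c *: u + v); rewrite !dotE (dotC v u); lra. Qed.

End InnerProduct.

(** * The step parameter and the residual operator *)


(** As gamma tends to 0 the left-hand side of the condition tends to
[192 * (L * rho) ^+ 2], which is below 1; an explicit gamma is obtained by
spending the gap on the terms in gamma. *)
Lemma gamma_exists {R : realType} (L rho : R) :
  0 < L -> 0 <= rho -> 8 * Num.sqrt 3 * L * rho < 1 ->
  exists2 gamma : R, 0 < gamma & gamma_cond L rho gamma.
Proof.
move=> L_gt0 rho_ge0 small.
have r_ge0 : 0 <= L * rho by rewrite mulr_ge0 // ltW.
have r_lt : 192 * (L * rho) ^+ 2 < 1.
  have -> : 192 * (L * rho) ^+ 2 = (8 * Num.sqrt 3 * L * rho) ^+ 2.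
    by rewrite !exprMn sqr_sqrtr ?ler0n //; ring.
  rewrite expr_lt1 //.
  by rewrite -mulrA mulr_ge0 // mulr_ge0 // sqrtr_ge0.
have r_lt1 : L * rho < 1 by nra.
(* After scaling, with r = L rho and g = L gamma, the terms in g are
   16 g (29 g + 37 r) <= 16 * 66 g = 1056 g as soon as g, r <= 1. *)
pose g := (1 - 192 * (L * rho) ^+ 2) / 1056.
have g_gt0 : 0 < g by rewrite /g; lra.
have g_lt1 : g < 1 by rewrite /g; nra.
exists (g / L); first by rewrite divr_gt0.
rewrite /gamma_cond.
have -> : 16 * L ^+ 2 * (3 * (3 * (g / L) + 2 * rho) ^+ 2
            + g / L * (2 * (g / L) + rho))
        = 16 * g * (29 * g + 37 * (L * rho)) + 192 * (L * rho) ^+ 2.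
  by field; rewrite gt_eqF.
have -> : 192 * (L * rho) ^+ 2 = 1 - 1056 * g by rewrite /g; field.
nra.
Qed.

(** Since x is the resolvent of x + eta xi, the residual is a difference of two
values of the nonexpansive J, taken at points that differ by eta (F x + xi). *)
Lemma residual_le {R : realType} {p : nat} {eta : R} (F : 'rV[R]_p -> 'rV[R]_p)
    {T : 'rV[R]_p -> set 'rV[R]_p} {J : 'rV[R]_p -> 'rV[R]_p} {x xi : 'rV[R]_p} :
  0 < eta -> single_valued_as (resolvent eta T) J -> nonexpansive J -> T x xi ->
  enorm (residual eta F J x) ^+ 2 <= enorm (F x + xi) ^+ 2.
Proof.
move=> eta_gt0 JT neJ Txi.
have xE : x = J (x + eta *: xi).
  have : resolvent eta T (x + eta *: xi) x by exists xi.
  by rewrite JT.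
rewrite /residual {1}xE !enorm_sqr dotZl dotZr mulrA -invfM mulrC.
rewrite ler_pdivrMr ?mulr_gt0 //.
have := elipschitz_sqr (x + eta *: xi) (x - eta *: F x) neJ.
rewrite (_ : _ - (x - _) = eta *: (F x + xi)); last first.
  by apply/rowP => i; rewrite !mxE; ring.
rewrite expr1n mul1r dotZl dotZr; lra.
Qed.

(** * Identities and inequalities behind the decrease of the potential *)

Section OneStep.
Context {R : realType} {p : nat}.

(** The recursion [(s + 1) u' = s u + d] expresses [s (u' - u)] as [d - u'] and
[(s + 1) (u' - u)] as [d - u]; pairing the former with [w'] and the latter with
[w] leaves only inner products of vectors of the same index, plus [d]. *)
Lemma monotone_telescope {s : R} (w w' : 'rV[R]_p) {u u' d : 'rV[R]_p} :
  (s + 1) *: u' = s *: u + d ->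
  (s + 1) * s * dot (w' - w) (u' - u)
  = s * dot w u - (s + 1) * dot w' u' + dot ((s + 1) *: w' - s *: w) d.
Proof.
move=> eq_u.
have -> : d = (s + 1) *: u' - s *: u by rewrite eq_u addrC addKr.
by rewrite !dotE; ring.
Qed.

(** Trades the weight [(s + 1) * s] of a co-hypomonotonicity defect for the
increment of the scaled vectors, up to terms that telescope. *)
Lemma weighted_square (s : R) (w w' : 'rV[R]_p) :
  dot ((s + 1) *: w' - s *: w) ((s + 1) *: w' - s *: w)
  = (s + 1) * s * dot (w' - w) (w' - w) + (s + 1) * dot w' w' - s * dot w w.
Proof. by rewrite !dotE (dotC w w'); ring. Qed.

(** Here [a] and [b] stand for the scaled residuals at two successive indices
and [a_], [b_] for their surrogates.  With e = a - a_, f = b - b_ and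
q = eta / 2 = 3 gamma + 2 rho, the part of the inner product carrying eta is
[[
  - q |a - b|^2 - q |a_ - b_|^2 + q |e - f|^2,
]]
and the part carrying gamma is the telescoping gamma/2 (|b|^2 - |a|^2), plus
gamma/2 |a - b|^2 + gamma <a - b, f>.  The first square pays for every other
multiple of |a - b|^2.  In |e - f|^2 <= 2 |e|^2 + 2 |f|^2, the second one, at
least 12 |e|^2 by hypothesis, pays for the term in e and still leaves 3 q |e|^2
to store for the next step; the 3 q |f|^2 stored before pays for the term in f. *)
Lemma cross_term_bound {gamma rho : R} (a b : 'rV[R]_p) {a_ b_ : 'rV[R]_p} :
  0 < gamma -> 0 <= rho ->
  let eta := eta_ gamma rho in
  12 * dot (a - a_) (a - a_) <= dot (a_ - b_) (a_ - b_) ->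
  dot (a - b) ((eta - gamma) *: b_ - eta *: a_)
    + (rho + gamma / 2) * dot (a - b) (a - b)
    + gamma / 2 * dot a a + 3 / 2 * eta * dot (a - a_) (a - a_)
  <= gamma / 2 * dot b b + 3 / 2 * eta * dot (b - b_) (b - b_).
Proof.
move=> gamma_gt0 rho_ge0 eta err; rewrite /eta /eta_ {eta}.
have g0 := ltW gamma_gt0.
set e := a - a_; set f := b - b_; set q := 3 * gamma + 2 * rho.
have q0 : 0 <= q by rewrite /q; lra.
(* The inequality is a nonnegative combination of the following ones. *)
have ee := mulr_ge0 q0 (dot_ge0 e).
have sq_ef := mulr_ge0 q0 (dot_ge0 (e + f)).
have sq_uf := mulr_ge0 g0 (dot_ge0 (a - b - f)).
have uu := mulr_ge0 g0 (dot_ge0 (a - b)).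
have ruu := mulr_ge0 rho_ge0 (dot_ge0 (a - b)).
have ff := mulr_ge0 g0 (dot_ge0 f).
have rff := mulr_ge0 rho_ge0 (dot_ge0 f).
have qerr := ler_wpM2l q0 err.
move: ee sq_ef sq_uf uu ruu ff rff qerr; rewrite /e /f /q !dotE.
rewrite (dotC b a) (dotC a_ a) (dotC b_ a) (dotC a_ b) (dotC b_ b) (dotC b_ a_).
move: (dot a a) (dot a b) (dot a a_) (dot a b_) (dot b b) (dot b a_) (dot b b_)
  (dot a_ a_) (dot a_ b_) (dot b_ b_) => *.
nra.
Qed.

End OneStep.

(** * The iterates *)

Section Iterates.
Context {R : realType} {p : nat}.
Context {F : 'rV[R]_p -> 'rV[R]_p} {T : 'rV[R]_p -> set 'rV[R]_p}.
Context {gamma rho : R} {xi0 : 'rV[R]_p} {x y z wh : nat -> 'rV[R]_p}.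
Hypotheses (gamma_gt0 : 0 < gamma) (rho_ge0 : 0 <= rho).
Local Notation eta := (eta_ gamma rho).
Hypothesis run : apeg F T gamma eta (etah_ gamma rho) theta_ nu_ xi0 x y z wh.

Let eta_gt0 : 0 < eta.
Proof. by move: gamma_gt0 rho_ge0; rewrite /eta_; lra. Qed.

Let t_gt0 k : 0 < t_ k :> R.
Proof. by rewrite ltr0n addn2. Qed.

Let tS k : t_ k.+1 = t_ k + 1 :> R.
Proof. by rewrite /t_ addSn -natr1. Qed.

Lemma apeg_xiP k : T (x k) (apeg_xi F y wh k).
Proof.
have [xi Txi eq_xi] := apeg_x run k.
suff -> : apeg_xi F y wh k = xi by [].
rewrite /apeg_xi (apeg_wh run).
have -> : y k - x k + etah_ gamma rho k
    *: what_pred eta (etah_ gamma rho) (F (x 0) + xi0) wh k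
    = eta *: xi + eta *: F (y k).
  apply/rowP => i; move/rowP: eq_xi => /(_ i); rewrite !mxE => eq_i.
  by lra.
by rewrite -scalerDr scalerA mulVf ?gt_eqF // scale1r addrK.
Qed.

(** The initial value eta / etah_0 w_0 is designed for this: it cancels the
factor etah_0 in front of it. *)
Lemma wh0E : wh 0 = F (x 0) + xi0.
Proof.
rewrite (apeg_wh run) /= (apeg_y0 run) subrr add0r !scalerA.
suff -> : eta^-1 * (etah_ gamma rho 0 * (eta / etah_ gamma rho 0)) = 1.
  by rewrite scale1r.
have t0 : t_ 0 = 2 :> R by [].
have neq0 : etah_ gamma rho 0 != 0.
  by rewrite gt_eqF // /etah_ t0 divr_gt0 // mulr_gt0 //; lra.
by rewrite [X in _ * X]mulrCA mulfV // mulr1 mulVf // gt_eqF.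
Qed.

(** Multiplying the update of y by [t_ k.+1] shows that z + t (y - z) is
invariant, so y_k is a convex combination of z_k and the fixed anchor x_0. *)
Lemma halpern k : t_ k *: y k = x 0 + (t_ k - 1) *: z k.
Proof.
elim: k => [|k IHk].
  rewrite (apeg_y0 run) (apeg_z0 run) /t_ /=.
  by apply/rowP => i; rewrite !mxE; lra.
apply/rowP => i; move/rowP: IHk => /(_ i).
rewrite (apeg_y run) !mxE /theta_ /nu_ => IHi.
have -> : x 0%N 0 i = t_ k * y k 0 i - (t_ k - 1) * z k 0 i by rewrite IHi; ring.
have := t_gt0 k; rewrite tS => tk; field.
by rewrite gt_eqF //; lra.
Qed.

Lemma apeg_step k :
  x k.+1 = y k.+1 + (t_ k / t_ k.+1 * eta) *: wh k - eta *: wh k.+1.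
Proof.
rewrite (apeg_wh run k.+1) /= scalerA mulfV ?gt_eqF // scale1r.
have -> : etah_ gamma rho k.+1 = t_ k / t_ k.+1 * eta.
  by rewrite /etah_ tS addrK mulrAC.
by apply/rowP => i; rewrite !mxE; ring.
Qed.

Lemma anchored_step k :
  t_ k.+1 *: (x k.+1 - x 0)
  = t_ k *: (x k - x 0)
    + ((eta - gamma) *: (t_ k *: wh k) - eta *: (t_ k.+1 *: wh k.+1)).
Proof.
apply/rowP => i; move/rowP: (halpern k.+1) => /(_ i).
rewrite apeg_step (apeg_z run) !mxE tS.
have := t_gt0 k => tk eq_i.
have -> : x 0%N 0 i = (t_ k + 1) * y k.+1 0 i
   - (t_ k + 1 - 1) * (x k 0 i - gamma * wh k 0 i) by rewrite eq_i; ring.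
field.
by rewrite gt_eqF //; lra.
Qed.

Lemma apeg_gap k :
  t_ k.+1 *: (x k.+1 - y k.+1) = eta *: (t_ k *: wh k - t_ k.+1 *: wh k.+1).
Proof.
rewrite apeg_step; apply/rowP => i; rewrite !mxE.
by move: (t_ k.+1) (t_gt0 k.+1) => t t_pos; field; rewrite gt_eqF.
Qed.

Local Notation res k := (F (x k) + apeg_xi F y wh k).

(** * The potential and the rate *)

Lemma res_gap k : res k - wh k = F (x k) - F (y k).
Proof. by apply/rowP => i; rewrite !mxE; ring. Qed.

(** The coefficient [rho + gamma / 2], where co-hypomonotonicity alone would give
[rho], is responsible for the extra term 2 t in the rate t (t + 2). *)
Definition potential k : R :=
  t_ k * dot (res k) (x k - x 0)
  + gamma / 2 * dot (t_ k *: res k) (t_ k *: res k)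
  + (rho + gamma / 2) * t_ k * dot (res k) (res k)
  + 3 / 2 * eta * dot (t_ k *: (res k - wh k)) (t_ k *: (res k - wh k)).

Lemma res0E : res 0 = F (x 0) + xi0.
Proof. by rewrite /apeg_xi wh0E (apeg_y0 run) addrC subrK. Qed.

Lemma potential0 :
  potential 0 = (3 * gamma + 2 * rho)
    * dot (F (x 0) + xi0) (F (x 0) + xi0).
Proof.
rewrite /potential res0E wh0E (_ : t_ 0 = 2) // !subrr scaler0.
by rewrite -(subrr (x 0)) !dotE; field.
Qed.

Context {L : R}.
Hypotheses (lipF : elipschitz L F).
Hypothesis gammaP : gamma_cond L rho gamma.
Hypothesis coF : co_hypomonotone rho (sum_op F T).

(** The condition on gamma contains 12 (L eta)^2 <= 1, while the Lipschitz
property bounds the left-hand side without the factor 12 by (L eta)^2 times the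
right-hand side. *)
Lemma apeg_err k :
  12 * dot (t_ k.+1 *: (res k.+1 - wh k.+1)) (t_ k.+1 *: (res k.+1 - wh k.+1))
  <= dot (t_ k.+1 *: wh k.+1 - t_ k *: wh k)
         (t_ k.+1 *: wh k.+1 - t_ k *: wh k).
Proof.
have Leta : 12 * (L ^+ 2 * eta ^+ 2) <= 1.
  apply: le_trans gammaP; rewrite /eta_ -subr_ge0.
  rewrite (_ : _ - _ = 16 * L ^+ 2 * (gamma * (2 * gamma + rho))); last by ring.
  have g0 := ltW gamma_gt0.
  have := mulr_ge0 (sqr_ge0 L) (sqr_ge0 gamma).
  have := mulr_ge0 (sqr_ge0 L) (mulr_ge0 g0 rho_ge0).
  lra.
set d := _ - _ *: wh k.
have dd : t_ k.+1 ^+ 2 * dot (x k.+1 - y k.+1) (x k.+1 - y k.+1)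
    = eta ^+ 2 * dot d d.
  transitivity (dot (t_ k.+1 *: (x k.+1 - y k.+1)) (t_ k.+1 *: (x k.+1 - y k.+1))).
    by rewrite dotZl dotZr mulrA.
  by rewrite apeg_gap dotZl dotZr mulrA /d -opprB dotNl dotNr opprK.
have := elipschitz_sqr (x k.+1) (y k.+1) lipF.
move=> /(ler_wpM2l (sqr_ge0 (t_ k.+1))); rewrite mulrCA dd => lip.
rewrite res_gap dotZl dotZr.
have := ler_wpM2r (dot_ge0 d) Leta; lra.
Qed.

(** Co-hypomonotonicity between successive iterates, weighted by
[t_ k.+1 * t_ k] and telescoped, bounds the increment of the first term of the
potential by the cross term, which [cross_term_bound] controls. *)
Lemma potential_decrease k : potential k.+1 <= potential k.
Proof.
have inc j : sum_op F T (x j) (res j).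
  by exists (apeg_xi F y wh j) => //; exact: apeg_xiP.
have := coF _ _ _ _ (inc k.+1) (inc k); rewrite enorm_sqr.
set w' := res k.+1; set w := res k => mono.
have weak : - (rho + gamma / 2) * dot (w' - w) (w' - w)
    <= dot (w' - w) ((x k.+1 - x 0) - (x k - x 0)).
  rewrite (_ : x k.+1 - x 0 - (x k - x 0) = x k.+1 - x k); last first.
    by apply/rowP => i; rewrite !mxE; ring.
  by have := mulr_ge0 (ltW gamma_gt0) (dot_ge0 (w' - w)); lra.
have s_gt0 := t_gt0 k.
have := anchored_step k; rewrite tS => /(monotone_telescope w w') tele.
have ss : 0 <= (t_ k + 1) * t_ k :> R by rewrite mulr_ge0 // ltW // addr_gt0.
have := ler_wpM2l ss weak; rewrite tele.
have := apeg_err k; rewrite tS !scalerBr -/w' => err.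
have := cross_term_bound ((t_ k + 1) *: w') (t_ k *: w) gamma_gt0 rho_ge0 err.
rewrite /potential tS -/w -/w' !scalerBr.
set A := dot _ (_ - eta *: _).
set E1 := dot (_ - (t_ k + 1) *: wh k.+1) _.
set E2 := dot (_ - t_ k *: wh k) _.
rewrite weighted_square.
lra.
Qed.

Lemma potential_le0 k : potential k <= potential 0.
Proof.
by elim: k => // k; apply: le_trans; exact: potential_decrease.
Qed.

(** The lower bound <w_k, x_k - xs> >= - rho |w_k|^2 cancels the rho part of the
potential and leaves gamma/2 t (t + 1) |w_k|^2 + t <w_k, xs - x_0>; after
multiplication by gamma, Young's inequality keeps
gamma^2/4 t (t + 2) |w_k|^2 of it. *)
Lemma apeg_rate (xs : 'rV[R]_p) k : zer (sum_op F T) xs ->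
  enorm (res k) ^+ 2 <=
    (4 * enorm (x 0%N - xs) ^+ 2
     + 8 * gamma * (5 * gamma + 2 * rho) * enorm (F (x 0%N) + xi0) ^+ 2)
    / (gamma ^+ 2 * (k + 2)%:R * (k + 4)%:R).
Proof.
move=> zer_xs; rewrite !enorm_sqr.
have inc : sum_op F T (x k) (res k).
  by exists (apeg_xi F y wh k) => //; exact: apeg_xiP.
have := coF _ _ _ _ inc zer_xs; rewrite enorm_sqr subr0.
have := potential_le0 k; rewrite potential0 /potential.
set w := res k; set w0 := F (x 0) + xi0.
have -> : (k + 4)%:R = t_ k + 2 :> R by rewrite -natrD -addnA.
rewrite -/(t_ k); have := t_gt0 k; move: (t_ k : R) => t t_pos pot mono.
rewrite ler_pdivlMr; last by rewrite !mulr_gt0 ?exprn_gt0 ?addr_gt0.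
(* Half of the coefficient (gamma t)^2 / 2 of |w|^2 in gamma times the potential
   pays for the linear term in xs - x_0. *)
have young := dot_young (gamma * t / 2) w (xs - x 0).
have eq_d : dot (xs - x 0) (xs - x 0) = dot (x 0 - xs) (x 0 - xs).
  by rewrite -opprB dotNl dotNr opprK.
have eq_x : dot w (x k - x 0) = dot w (x k - xs) + dot w (xs - x 0).
  by rewrite -dotDr addrA subrK.
have err := mulr_ge0 (ltW eta_gt0) (dot_ge0 (t *: (w - wh k))).
have gpot := ler_wpM2l (ltW gamma_gt0) pot.
have gerr := mulr_ge0 (ltW gamma_gt0) err.
have gmono := ler_wpM2l (ltW (mulr_gt0 gamma_gt0 t_pos)) mono.
have g2w0 := mulr_ge0 (mulr_ge0 (ltW gamma_gt0) (ltW gamma_gt0)) (dot_ge0 w0).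
have grw0 := mulr_ge0 (mulr_ge0 (ltW gamma_gt0) rho_ge0) (dot_ge0 w0).
move: gpot young gmono gerr g2w0 grw0.
rewrite eq_x eq_d (dotZl t w) (dotZr t w w).
lra.
Qed.

End Iterates.

Theorem theorem4p1 (R : realType) (p : nat)
    (F : 'rV[R]_p -> 'rV[R]_p) (T : 'rV[R]_p -> set 'rV[R]_p) (L rho : R) :
  0 < L -> elipschitz L F ->
  0 <= rho -> co_hypomonotone rho (sum_op F T) ->
  8 * Num.sqrt 3 * L * rho < 1 ->
  zer (sum_op F T) !=set0 ->
  (exists2 gamma : R, 0 < gamma & gamma_cond L rho gamma) /\
  (forall (xs : 'rV[R]_p) (gamma : R) (xi0 : 'rV[R]_p)
      (x y z wh : nat -> 'rV[R]_p),
    zer (sum_op F T) xs ->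
    0 < gamma -> gamma_cond L rho gamma ->
    apeg F T gamma (eta_ gamma rho) (etah_ gamma rho) theta_ nu_
      xi0 x y z wh ->
    let bound (k : nat) : R :=
      (4 * enorm (x 0%N - xs) ^+ 2
       + 8 * gamma * (5 * gamma + 2 * rho) * enorm (F (x 0%N) + xi0) ^+ 2)
      / (gamma ^+ 2 * (k + 2)%:R * (k + 4)%:R) in
    (forall k : nat,
      T (x k) (apeg_xi F y wh k) /\
      enorm (F (x k) + apeg_xi F y wh k) ^+ 2 <= bound k) /\
    (forall J : 'rV[R]_p -> 'rV[R]_p,
      single_valued_as (resolvent (eta_ gamma rho) T) J ->
      nonexpansive J ->
      forall k : nat,
        enorm (residual (eta_ gamma rho) F J (x k)) ^+ 2 <= bound k)).
Proof.
move=> L_gt0 lipF rho_ge0 coF small _; split; first exact: gamma_exists.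
move=> xs gamma xi0 x y z wh zer_xs gamma_gt0 gammaP run bound.
have rate k : enorm (F (x k) + apeg_xi F y wh k) ^+ 2 <= bound k.
  exact: (apeg_rate gamma_gt0 rho_ge0 run lipF gammaP coF).
split=> [k|J JT neJ k].
  by split; first exact: (apeg_xiP gamma_gt0 rho_ge0 run).
apply: le_trans (rate k); apply: (residual_le F _ JT neJ).
  by rewrite /eta_; lra.
exact: (apeg_xiP gamma_gt0 rho_ge0 run).
Qed.
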